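(* Let $N$ be a prime number and $\delta,\alpha\in(0,1]$ real numbers with $32\delta^2\le\alpha\le\delta/4$. Suppose there is a positive integer $k$ with $2\le k\le\frac12\log(1/\delta)$ and $$2k\max\Big\{\log\Big(\frac{2^6\delta k}{\alpha^2}\Big),\ \log\Big(\frac{2^6\delta^2}{\alpha^3}\Big)\Big\}\le\log N. \qquad ( * )$$ Then there exists a set $A\subseteq\mathbb{Z}_N$ such that $\delta N\le|A|\le3\delta N$, $|\mathcal{R}_\alpha(A)|\ge\frac{\delta}{64\alpha^2}$, and for every integer $k$ with $2\le k\le\frac12\log(1/\delta)$ satisfying $( * )$ we have $T_k(\mathcal{R}_\alpha(A))\le\frac{2^{14k}\delta}{\alpha^{2k}}$.
   Context: $\mathbb{Z}_N=\mathbb{Z}/N\mathbb{Z}$; $\log$ is the logarithm to base $2$. For $f:\mathbb{Z}_N\to\mathbb{C}$, $\widehat f(r)=\sum_n f(n)e^{2\pi i nr/N}$; $A(x)$ is the indicator of $A$, and $\mathcal{R}_\alpha(A)=\{r\in\mathbb{Z}_N:|\widehat A(r)|\ge\alpha N\}$. For $B\subseteq\mathbb{Z}_N$ and a positive integer $k$, $T_k(B)=|\{(r_1,\dots,r_k,r_1',\dots,r_k')\in B^{2k}: r_1+\dots+r_k=r_1'+\dots+r_k'\}|$. *)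

(* Defs.v *)
From HB Require Import structures.
From mathcomp Require Import all_boot all_order all_algebra.
From mathcomp Require Import all_classical all_reals all_analysis.
Set Implicit Arguments. Unset Strict Implicit. Unset Printing Implicit Defensive.
Import Order.TTheory GRing.Theory Num.Theory.
Local Open Scope ring_scope.

Definition log2 {R : realType} (x : R) : R := ln x / ln 2.

(* Real and imaginary parts of hat A (r) = sum_{n in A} e^{2 pi i n r / N},
   for A a subset of Z_N (elements represented by their canonical
   representatives in [0, N)). *)
Definition fourier_re (R : realType) (N : nat) (A : {set 'Z_N}) (r : 'Z_N) : R :=
  \sum_(n in A) cos (2 * pi * (val n * val r)%:R / N%:R).
Definition fourier_im (R : realType) (N : nat) (A : {set 'Z_N}) (r : 'Z_N) : R :=
  \sum_(n in A) sin (2 * pi * (val n * val r)%:R / N%:R).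

Definition fourier_abs (R : realType) (N : nat) (A : {set 'Z_N}) (r : 'Z_N) : R :=
  Num.sqrt (fourier_re R A r ^+ 2 + fourier_im R A r ^+ 2).

Definition large_spectrum {R : realType} (N : nat) (alpha : R) (A : {set 'Z_N})
  : {set 'Z_N} :=
  [set r : 'Z_N | alpha * N%:R <= fourier_abs R A r].

Definition additive_energy (N k : nat) (B : {set 'Z_N}) : nat :=
  #|[set t : {ffun 'I_k -> 'Z_N} * {ffun 'I_k -> 'Z_N} |
      [forall i, (t.1 i \in B) && (t.2 i \in B)] &&
      ((\sum_(i < k) t.1 i) == (\sum_(i < k) t.2 i))]|.

Definition admissible_k {R : realType} (N : nat) (delta alpha : R) (k : nat) : Prop :=
  (2 <= k)%N /\ k%:R <= log2 (delta^-1) / 2 /\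
  2 * k%:R * Num.max (log2 (2 ^+ 6 * delta * k%:R / alpha ^+ 2))
                     (log2 (2 ^+ 6 * delta ^+ 2 / alpha ^+ 3))
    <= log2 (N%:R).

(* Main.v *)
(* Let P = [1, p] with p close to 2 alpha N, and let A be the union of
   m = floor (delta / alpha) dilates {x : q_i x in P}. The transform of the
   i-th dilate at r is that of P at r / q_i, which is at least 7 p / 10 when
   |r / q_i| <= 1 / (32 alpha) and at most N / |r / q_i| in general. For
   generic q_i the dilates overlap in at most 10 delta^2 N elements, which is
   small against alpha N because 32 delta^2 <= alpha, and no r != 0 has two of
   the quotients r / q_i small. Hence the spectrum lies between unions of m
   dilated intervals q_i [-c / alpha, c / alpha].
   If the q_i moreover satisfy no short linear relation with small
   coefficients, then a solution of r_1 + ... + r_k = r'_1 + ... + r'_k in the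
   spectrum has vanishing sum within each dilated interval, and there are
   O(1)^k (delta / alpha) alpha^-(2k-1) such solutions; the smallness of
   delta 2^(2k) makes the terms involving several intervals negligible.
   Each condition on q excludes linear relations sum_i c_i q_i = 0, and a
   uniform q satisfies a given one with probability 1 / N, so a suitable q
   exists by averaging. Taking for k the largest admissible value handles all
   admissible values at once. *)

Require Import Defs.
From HB Require Import structures.
From mathcomp Require Import all_boot all_order all_algebra.
From mathcomp Require Import all_classical all_reals all_analysis.
From mathcomp Require Import zify ring lra.
Set Implicit Arguments. Unset Strict Implicit. Unset Printing Implicit Defensive.
Import Order.TTheory GRing.Theory Num.Theory.
Import numFieldNormedType.Exports.
Local Open Scope ring_scope.

(** * Linear relations and balanced words *)

Lemma card_ZN (N : nat) : (1 < N)%N -> #|'Z_N| = N.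
Proof. by move=> N1; rewrite card_ord Zp_cast. Qed.

Lemma unit_ZN (N : nat) (x : 'Z_N) : prime N -> x != 0 -> x \is a GRing.unit.
Proof.
move=> pN x0; have N1 := prime_gt1 pN.
rewrite -(natr_Zp x) unitZpE // prime_coprime // gtnNdvd //.
  by rewrite lt0n; apply: contra x0 => /eqP xE; apply/eqP/val_inj.
by have := ltn_ord x; rewrite [X in (_ < X)%N]Zp_cast.
Qed.

(** Adding [t] to the coordinate [i0] changes the sum by [c i0 * t], and [c i0] is a unit; hence the
    [N] translates of the solution set in this direction are disjoint. *)
Lemma card_linear_relation (N m : nat) (c : 'I_m -> 'Z_N) :
  prime N -> (exists i, c i != 0) ->
  (N * #|[set q : {ffun 'I_m -> 'Z_N} | (\sum_i c i * q i == 0)%R]| <= N ^ m)%N.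
Proof.
move=> pN [i0 ci0]; have N1 := prime_gt1 pN.
set S := [set q | _].
pose shift (tq : 'Z_N * {ffun 'I_m -> 'Z_N}) : {ffun 'I_m -> 'Z_N} :=
  [ffun i => tq.2 i + (i == i0)%:R * tq.1].
have sumE t q : \sum_i c i * shift (t, q) i = \sum_i c i * q i + c i0 * t.
  under eq_bigr => i _ do rewrite ffunE mulrDr.
  rewrite big_split /=; congr (_ + _).
  rewrite (bigD1 i0) //= eqxx mul1r big1 ?addr0 // => i /negPf ->.
  by rewrite mul0r mulr0.
have inj : {in finset.setX [set: 'Z_N] S &, injective shift}.
  move=> [t q] [t' q']; rewrite !inE /= => /eqP q0 /eqP q'0 E.
  have tE : t = t'.
    have := sumE t q; rewrite E sumE q0 q'0 !add0r => /esym.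
    by apply: mulrI; apply: unit_ZN.
  rewrite tE in E *; congr pair; apply/ffunP => i.
  by move/ffunP/(_ i): E; rewrite !ffunE /=; apply: addIr.
rewrite -[X in (X * _)%N](card_ZN N1) -cardsT -cardsX -(card_in_imset inj).
by rewrite (leq_trans (max_card _)) // card_ffun !card_ord Zp_cast.
Qed.

(* The last entry of every class of [f] is determined by the others, so a
   solution is known from its values outside a set of representatives. *)
Lemma card_zero_classes (V : finZmodType) (I J : finType) (f : I -> J)
    (H : {set V}) :
  (#|[set s : {ffun I -> V} | [forall a, s a \in H] &&
        [forall j, (\sum_(a | f a == j) s a == 0)%R]]|
     <= #|H| ^ (#|I| - #|[set f x | x in I]|))%N.
Proof.
pose rep j := [pick a | f a == j].
pose Rep := [set a | rep (f a) == Some a].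
have f_inj : {in Rep &, injective f}.
  move=> a b; rewrite !inE => /eqP ra /eqP rb E.
  by move: ra; rewrite E rb => -[].
have f_Rep : f @: Rep = [set f x | x in I].
  apply/setP => j; apply/imsetP/imsetP => -[a aP ->]; first by exists a.
  rewrite /=; case E : (rep (f a)) => [b|]; last first.
    by move: E; rewrite /rep; case: pickP => // /(_ a); rewrite eqxx.
  have fb : f b = f a by move: E; rewrite /rep; case: pickP => // c /eqP <- [<-].
  by exists b; rewrite // inE fb E.
have -> : (#|I| - #|[set f x | x in I]| = #|~: Rep|)%N.
  by rewrite -f_Rep (card_in_imset f_inj) -(cardsC Rep) addKn.
set S := [set s | _].
pose g (s : {ffun I -> V}) : {ffun I -> V} :=
  [ffun a => if a \in Rep then 0 else s a].
have inj : {in S &, injective g}.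
  move=> s s'; rewrite !inE => /andP[_ /forallP s0] /andP[_ /forallP s'0] E.
  have off a : a \notin Rep -> s a = s' a.
    by move=> /negPf aR; move/ffunP/(_ a): E; rewrite !ffunE aR.
  apply/ffunP => a; have [aR|] := boolP (a \in Rep); last exact: off.
  have := etrans (eqP (s0 (f a))) (esym (eqP (s'0 (f a)))).
  rewrite (bigD1 a) //= [in RHS](bigD1 a) //=.
  rewrite (eq_bigr s') => [/addIr //|b /andP[/eqP fb ba]].
  by apply: off; apply: contra ba => bR; apply/eqP/f_inj.
rewrite -(card_in_imset inj) -(card_pffun_on 0); apply: subset_leq_card.
apply/fintype.subsetP => _ /imsetP[s + ->]; rewrite inE => /andP[/forallP sH _].
apply/pffun_onP; split; first by apply/fintype.subsetP => a; rewrite !inE ffunE;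
  case: ifP => [|/negbT]; rewrite !inE ?eqxx.
move=> v /fintype.imageP[a]; rewrite !inE => aR ->; rewrite ffunE.
by rewrite !inE (negPf aR).
Qed.

Lemma card_fun_image (I J : finType) (B : {set J}) :
  (#|[set f : {ffun I -> J} | [set f x | x in I] == B]| <= #|B| ^ #|I|)%N.
Proof.
rewrite -card_ffun_on; apply: subset_leq_card; apply/fintype.subsetP => f.
rewrite inE => /eqP <-; apply/ffun_onP => a; exact: imset_f.
Qed.

(** For [V] equal to ['Z_N] these are the relations among dilation factors that hold whatever the
    factors are: the letters [(j, v)] with the same index [j] cancel. *)
Definition balanced_words (V : finZmodType) (I J : finType) (H : {set V}) :
    {set {ffun I -> J * V}} :=
  [set w : {ffun I -> J * V} | [forall a, (w a).2 \in H] &&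
     [forall j, \sum_(a | (w a).1 == j) (w a).2 == 0]].

(** Words are sorted by their index function, then by its image [B]: at most [#|B| ^ #|I|] functions
    have this image, and [card_zero_classes] counts the values that each of them allows. *)
Lemma card_balanced_words (V : finZmodType) (I J : finType) (H : {set V}) :
  (#|balanced_words I J H|
     <= \sum_(B : {set J} | #|B| <= #|I|) #|B| ^ #|I| * #|H| ^ (#|I| - #|B|))%N.
Proof.
pose fstw (w : {ffun I -> J * V}) : {ffun I -> J} := [ffun a => (w a).1].
pose sndw (w : {ffun I -> J * V}) : {ffun I -> V} := [ffun a => (w a).2].
rewrite -sum1_card (partition_big fstw predT) //=.
apply: (@leq_trans (\sum_(f : {ffun I -> J})
    #|H| ^ (#|I| - #|[set f x | x in I]|))%N).
  apply: leq_sum => f _; rewrite sum1dep_card.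
  apply: leq_trans (card_zero_classes f H).
  set S := [set w | _].
  have inj : {in S &, injective sndw}.
    move=> w w'; rewrite !inE => /andP[_ /eqP wf] /andP[_ /eqP w'f] /ffunP E.
    apply/ffunP => a; move: (E a); rewrite !ffunE => E2.
    move: wf; rewrite -w'f => /ffunP/(_ a); rewrite !ffunE.
    by case: (w a) (w' a) E2 => ? ? [? ?] /= -> ->.
  rewrite -(card_in_imset inj); apply: subset_leq_card.
  apply/fintype.subsetP => _ /imsetP[w + ->].
  rewrite !inE => /andP[/andP[/forallP wH /forallP w0] /eqP wf].
  apply/andP; split; apply/forallP => x; rewrite ?ffunE //.
  apply/eqP; rewrite -[RHS](eqP (w0 x)); apply: eq_big => [a|a _]; last by rewrite ffunE.
  by rewrite -wf ffunE.
rewrite (partition_big (fun f : {ffun I -> J} => [set f x | x in I])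
  (fun B => (#|B| <= #|I|)%N)) => [|f _] /=; last exact: leq_imset_card.
apply: leq_sum => B _.
under eq_bigr => f /eqP -> do [].
rewrite sum_nat_const leq_mul2r; apply/orP; right.
by rewrite -sum1_card; apply: leq_trans (card_fun_image I B); rewrite sum1dep_card.
Qed.

Lemma bin_le_exp (m d : nat) : ('C(m, d) <= m ^ d)%N.
Proof.
have ffactle : (m ^_ d <= m ^ d)%N.
  elim: d => [|d IH]; first by rewrite ffactn0.
  by rewrite ffactnSr expnSr leq_mul // leq_subr.
by apply: leq_trans ffactle; rewrite -bin_ffact leq_pmulr // fact_gt0.
Qed.

Lemma sum_half_le (R : realFieldType) (n : nat) :
  \sum_(i < n) 2^-1 ^+ i <= 2 :> R.
Proof.
suff -> : \sum_(i < n) 2^-1 ^+ i = 2 - 2 * 2^-1 ^+ n :> R.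
  by rewrite lerBlDr lerDl mulr_ge0 // exprn_ge0 // invr_ge0.
elim: n => [|n IH]; first by rewrite big_ord0 expr0; lra.
by rewrite big_ord_recr /= IH exprSr; lra.
Qed.

(* Words whose index has an image of size [D] contribute at most
   [m ^ D * D ^ n * h ^ (n - D)]; since [D <= 2 ^ (D - 1)], consecutive terms
   decrease by the factor [2 ^ n * m / h <= 1 / 2]. *)
Lemma card_balanced_words_le (R : realFieldType) (V : finZmodType)
    (I : finType) (m : nat) (H : {set V}) (h : R) :
  (0 < #|I|)%N -> #|H|%:R <= h -> 0 < h -> 2 ^+ #|I| * m%:R <= h / 2 ->
  #|balanced_words I 'I_m H|%:R <= 2 * m%:R * h ^+ #|I|.-1.
Proof.
move=> n0 Hh h0 small; have := card_balanced_words I 'I_m H.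
rewrite -(ler_nat R) => /le_trans; apply; move: small n0.
set n := #|I| => small n0.
rewrite (partition_big (fun B : {set 'I_m} => inord #|B| : 'I_n.+1) predT) //=.
(* The empty image contributes [0 ^ n = 0]; the remaining image sizes are [d.+1] with [d < n]. *)
rewrite natr_sum big_ord_recl big1 ?add0r => [|B /andP[Bn]]; last first.
  by rewrite -val_eqE /= inordK // => /eqP ->; rewrite exp0n.
have -> : 2 * m%:R * h ^+ n.-1 = (m%:R * h ^+ n.-1) * 2 by ring.
apply: le_trans (ler_wpM2l _ (sum_half_le R n)); last first.
  by rewrite mulr_ge0 ?ler0n // exprn_ge0 // ltW.
rewrite mulr_sumr; apply: ler_sum => d _.
apply: (@le_trans _ _ ('C(m, d.+1) * (d.+1 ^ n * #|H| ^ (n - d.+1)))%:R).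
  have -> : 'C(m, d.+1) = #|[set B : {set 'I_m} | #|B| == d.+1]|.
    by rewrite card_draws card_ord.
  rewrite ler_nat -sum1_card big_distrl /= big_mkcond [leqRHS]big_mkcond /=.
  apply: leq_sum => B _; rewrite inE -val_eqE /=.
  case: ifP => // /andP[Bn]; rewrite inordK // => /eqP ->.
  by rewrite eqxx mul1n.
have dn : (d.+1 <= n)%N := ltn_ord d.
have -> : h ^+ n.-1 = h ^+ d * h ^+ (n - d.+1).
  by rewrite -exprD; congr (_ ^+ _); lia.
rewrite !natrM !natrX.
have C1 : 'C(m, d.+1)%:R <= m%:R ^+ d.+1 :> R by rewrite -natrX ler_nat bin_le_exp.
have d1 : d.+1%:R ^+ n <= (2 ^+ n) ^+ d :> R.
  rewrite -exprM mulnC exprM -!natrX ler_nat leq_exp2r //.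
  by rewrite -[X in (X <= _)%N]/(d.+1) ltn_expl.
have h1 : #|H|%:R ^+ (n - d.+1) <= h ^+ (n - d.+1).
  by rewrite lerXn2r // ?nnegrE ?ler0n ?ltW.
apply: (@le_trans _ _ (m%:R ^+ d.+1 * ((2 ^+ n) ^+ d * h ^+ (n - d.+1)))).
  by do 2?[apply: ler_pM => //; rewrite ?mulr_ge0 ?exprn_ge0 ?ler0n //].
rewrite exprS.
have -> : m%:R * m%:R ^+ d * ((2 ^+ n) ^+ d * h ^+ (n - d.+1)) =
    m%:R * h ^+ (n - d.+1) * (2 ^+ n * m%:R) ^+ d :> R by rewrite exprMn; ring.
have -> : m%:R * (h ^+ d * h ^+ (n - d.+1)) * 2^-1 ^+ d =
    m%:R * h ^+ (n - d.+1) * (h / 2) ^+ d by rewrite exprMn; ring.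
apply: ler_wpM2l; first by rewrite mulr_ge0 ?ler0n // exprn_ge0 // ltW.
rewrite lerXn2r // ?nnegrE; first by rewrite mulr_ge0 ?exprn_ge0 ?ler0n.
by rewrite divr_ge0 // ltW.
Qed.

(** [minn z (N - z)] is the distance from [z] to 0 on the cycle ['Z_N], read off from the
    representative in [[0, N)]. *)
Definition zball (N M : nat) : {set 'Z_N} :=
  [set z : 'Z_N | (minn z (N - z) <= M)%N].

Lemma zballN (N M : nat) (z : 'Z_N) :
  (1 < N)%N -> z \in zball N M -> - z \in zball N M.
Proof.
move=> N1; have := ltn_ord z; rewrite !inE /=.
move: (nat_of_ord z) => a; rewrite !(Zp_cast N1).
case: a => [|a] aN; first by rewrite subn0 modnn !min0n.
by rewrite modn_small; lia.
Qed.

Lemma card_zball (N M : nat) : (1 < N)%N -> (#|zball N M| <= 2 * M.+1)%N.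
Proof.
move=> N1.
have sub : zball N M \subset [set (i%:R : 'Z_N) | i : 'I_M.+1] :|:
    [set (- i%:R : 'Z_N) | i : 'I_M.+1].
  apply/fintype.subsetP => z; rewrite inE geq_min => /orP[zM|zM].
    rewrite inE; apply/orP; left; apply/imsetP.
    by exists (Ordinal (zM : (z < M.+1)%N)); rewrite //= natr_Zp.
  rewrite inE; apply/orP; right; apply/imsetP.
  exists (Ordinal (zM : (N - z < M.+1)%N)) => //=.
  have zN : (z <= N)%N by have := ltn_ord z; rewrite [X in (_ < X)%N]Zp_cast // => /ltnW.
  by rewrite natrB // pchar_Zp // natr_Zp sub0r opprK.
apply: leq_trans (subset_leq_card sub) _.
apply: leq_trans (leq_card_setU _ _) _.
rewrite mul2n -addnn leq_add // -[X in (_ <= X)%N](card_ord M.+1).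
  exact: leq_imset_card.
exact: leq_imset_card.
Qed.

(** * Generic dilation factors *)

Definition word_value (N m : nat) (I : finType) (q : 'I_m -> 'Z_N)
  (w : I -> 'I_m * 'Z_N) : 'Z_N := \sum_a q (w a).1 * (w a).2.

(** Grouped by index, a word becomes a linear relation among the [q i], whose coefficients are the
    sums that [balanced_words] requires to vanish. *)
Lemma word_valueE (N m : nat) (I : finType) (q : 'I_m -> 'Z_N)
    (w : I -> 'I_m * 'Z_N) :
  word_value q w = \sum_i (\sum_(a | (w a).1 == i) (w a).2) * q i.
Proof.
rewrite /word_value (partition_big (fun a => (w a).1) predT) //=.
apply: eq_bigr => i _; rewrite mulr_suml; apply: eq_bigr => a /eqP ->.
exact: mulrC.
Qed.

(** No accidental relations: a word over [H] vanishes at [q] only if it vanishes identically. The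
    length [k + k] is the number of entries in a solution of
    [r_1 + ... + r_k = r'_1 + ... + r'_k]. *)
Definition dissociated (N m : nat) (q : 'I_m -> 'Z_N) (H : {set 'Z_N})
    (k : nat) : Prop :=
  forall w : {ffun 'I_k + 'I_k -> 'I_m * 'Z_N},
    (forall a, (w a).2 \in H) -> word_value q w = 0 ->
    w \in balanced_words ('I_k + 'I_k)%type 'I_m H.

(* The pair of tuples (q_(i_a) s_a), (q_(i'_a) s'_a) is encoded by the word
   (i_a, s_a), (i'_a, - s'_a). *)
Lemma additive_energy_le (N m k : nat) (q : 'I_m -> 'Z_N) (H B : {set 'Z_N}) :
  (0 < m)%N -> (forall s, s \in H -> - s \in H) ->
  (forall r, r \in B -> exists i, exists2 s, s \in H & r = q i * s) ->
  dissociated q H k ->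
  (additive_energy k B <= #|balanced_words ('I_k + 'I_k)%type 'I_m H|)%N.
Proof.
move=> m0 HN BP dis; pose i0 := Ordinal m0.
(* [r] may have several representations [q i * s]; one is fixed, and the default [(i0, 0)] is only
   met outside [B]. *)
pose rep r : 'I_m * 'Z_N := odflt (i0, 0) [pick x | (x.2 \in H) && (r == q x.1 * x.2)].
have repP r : r \in B -> (rep r).2 \in H /\ r = q (rep r).1 * (rep r).2.
  move=> /BP[i [s sH rE]]; rewrite /rep; case: pickP => [x /andP[? /eqP]//|].
  by move=> /(_ (i, s)); rewrite /= sH rE eqxx.
pose enc (t : {ffun 'I_k -> 'Z_N} * {ffun 'I_k -> 'Z_N}) :
    {ffun 'I_k + 'I_k -> 'I_m * 'Z_N} :=
  [ffun a => match a with
     | inl a => rep (t.1 a)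
     | inr a => ((rep (t.2 a)).1, - (rep (t.2 a)).2) end].
rewrite /additive_energy; set S := [set t | _].
have inj : {in S &, injective enc}.
  move=> [t1 t2] [u1 u2]; rewrite !inE => /andP[/forallP tB _] /andP[/forallP uB _].
  move=> /ffunP E; congr pair; apply/ffunP => a.
    have /andP[/repP[_ ->] _] := tB a; have /andP[/repP[_ ->] _] := uB a.
    by have := E (inl a); rewrite !ffunE /= => ->.
  have /andP[_ /repP[_ ->]] := tB a; have /andP[_ /repP[_ ->]] := uB a.
  have := E (inr a); rewrite !ffunE /= => E2.
  by rewrite (congr1 fst E2 : (rep _).1 = _) (oppr_inj (congr1 snd E2)).
rewrite -(card_in_imset inj); apply: subset_leq_card.
apply/fintype.subsetP => _ /imsetP[[t1 t2] + ->].
rewrite inE => /andP[/forallP tB /eqP tE]; apply: dis.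
  move=> [a|a]; rewrite ffunE /=; have /andP[/repP[? _] /repP[? _]] := tB a => //.
  exact: HN.
rewrite /word_value big_sumType /=.
under eq_bigr => a _ do rewrite ffunE /=.
under [X in _ + X]eq_bigr => a _ do rewrite ffunE /= mulrN.
rewrite sumrN (eq_bigr t1) => [|a _]; last first.
  by have /andP[/repP[_ <-]] := tB a.
rewrite [X in _ - X](eq_bigr t2) => [|a _]; last first.
  by have /andP[_ /repP[_ <-]] := tB a.
by rewrite /= in tE; rewrite tE subrr.
Qed.

(** After exchanging the two sums, each [w] is a nontrivial relation, satisfied by at most
    [N ^ m / N] vectors [q]. *)
Lemma first_moment (N m : nat) (J : finType) (W : {set J})
    (c : J -> 'I_m -> 'Z_N) :
  prime N -> (forall w, w \in W -> exists i, c w i != 0) ->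
  (N * \sum_(q : {ffun 'I_m -> 'Z_N})
         #|[set w in W | (\sum_i c w i * q i == 0)%R]| <= #|W| * N ^ m)%N.
Proof.
move=> pN cW.
have -> : (\sum_(q : {ffun 'I_m -> 'Z_N})
    #|[set w in W | (\sum_i c w i * q i == 0)%R]| =
  \sum_(w in W)
    #|[set q : {ffun 'I_m -> 'Z_N} | (\sum_i c w i * q i == 0)%R]|)%N.
  transitivity (\sum_(q : {ffun 'I_m -> 'Z_N}) \sum_(w in W)
      ((\sum_i c w i * q i == 0)%R : nat))%N.
    apply: eq_bigr => q _; rewrite -sum1dep_card big_mkcondr /=.
    by apply: eq_bigr => w _; case: eqP.
  rewrite exchange_big /=; apply: eq_bigr => w _.
  by rewrite -sum1dep_card [RHS]big_mkcond; apply: eq_bigr => q _; case: eqP.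
rewrite big_distrr /= -sum_nat_const; apply: leq_sum => w wW.
by apply: card_linear_relation; last exact: cW.
Qed.

(* For [H] a ball around 0, a collision is a frequency at which two dilates may
   both have a large transform; for [H] the interval [P], it is a point common
   to two dilates of [P]. *)
Definition collisions (N m : nat) (q : 'I_m -> 'Z_N) (H : {set 'Z_N}) :
    {set ('I_m * 'I_m) * ('Z_N * 'Z_N)} :=
  [set x | [&& x.1.1 != x.1.2, x.2.1 \in H, x.2.2 \in H, x.2.1 != 0 &
               q x.1.1 * x.2.1 == q x.1.2 * x.2.2]].

(** A collision is the relation [s * q i - t * q j = 0], nontrivial because [i != j] and
    [s != 0]. *)
Lemma sum_collisions (N m : nat) (H : {set 'Z_N}) :
  prime N ->
  (N * \sum_(q : {ffun 'I_m -> 'Z_N}) #|collisions q H|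
     <= (m * #|H|) ^ 2 * N ^ m)%N.
Proof.
move=> pN.
pose W := [set x : ('I_m * 'I_m) * ('Z_N * 'Z_N) |
  [&& x.1.1 != x.1.2, x.2.1 \in H, x.2.2 \in H & x.2.1 != 0]].
pose c (x : ('I_m * 'I_m) * ('Z_N * 'Z_N)) (i : 'I_m) : 'Z_N :=
  (i == x.1.1)%:R * x.2.1 - (i == x.1.2)%:R * x.2.2.
have cE x (q : {ffun 'I_m -> 'Z_N}) :
    \sum_i c x i * q i = q x.1.1 * x.2.1 - q x.1.2 * x.2.2.
  under eq_bigr => i _ do rewrite mulrBl.
  rewrite sumrB; congr (_ - _).
    rewrite (bigD1 x.1.1) //= eqxx mul1r mulrC big1 ?addr0 // => i /negPf ->.
    by rewrite !mul0r.
  rewrite (bigD1 x.1.2) //= eqxx mul1r mulrC big1 ?addr0 // => i /negPf ->.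
  by rewrite !mul0r.
have cW x : x \in W -> exists i, c x i != 0.
  rewrite inE => /and4P[xN _ _ x0]; exists x.1.1.
  by rewrite /c eqxx (negPf xN) mul1r mul0r subr0.
have leW : (#|W| <= (m * #|H|) ^ 2)%N.
  have -> : ((m * #|H|) ^ 2 =
      #|finset.setX [set: 'I_m * 'I_m] (finset.setX H H)|)%N.
    by rewrite !cardsX cardsT card_prod card_ord mulnACA.
  apply: subset_leq_card; apply/fintype.subsetP => -[[i j] [s t]].
  by rewrite !inE /= => /and4P[_ -> ->].
apply: leq_trans (leq_mul leW (leqnn _)).
apply: leq_trans (first_moment pN cW); rewrite leq_mul2l; apply/orP; right.
apply: leq_sum => q _; apply: subset_leq_card; apply/fintype.subsetP => x.
by rewrite !inE cE subr_eq0 -!andbA.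
Qed.

(** For uniform [q] the expected number of unbalanced vanishing words and of collisions in [H2] is
    at most 1/2 in total, and that of collisions in [P] is at most [(m * #|P|) ^ 2 / N]. Some [q]
    avoids the former and at most doubles the latter bound. *)
Lemma exists_generic (N m K : nat) (H1 H2 P : {set 'Z_N}) :
  prime N ->
  (2 * (\sum_(k < K.+1) (m * #|H1|) ^ (k + k) + (m * #|H2|) ^ 2) <= N)%N ->
  exists q : {ffun 'I_m -> 'Z_N},
    [/\ forall k, (k <= K)%N -> dissociated q H1 k,
        collisions q H2 = finset.set0 &
        (N * #|collisions q P| <= 2 * (m * #|P|) ^ 2)%N].
Proof.
move=> pN Nlarge.
pose c k (w : {ffun 'I_k + 'I_k -> 'I_m * 'Z_N}) i :=
  \sum_(a | (w a).1 == i) (w a).2.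
pose W k := [set w : {ffun 'I_k + 'I_k -> 'I_m * 'Z_N} |
  [forall a, (w a).2 \in H1] & [exists i, c k w i != 0]].
pose bad k (q : {ffun 'I_m -> 'Z_N}) :=
  [set w in W k | \sum_i c k w i * q i == 0].
have leW k : (#|W k| <= (m * #|H1|) ^ (k + k))%N.
  have -> : (m * #|H1| = #|finset.setX [set: 'I_m] H1|)%N.
    by rewrite cardsX cardsT card_ord.
  have -> : (k + k = #|{: 'I_k + 'I_k}|)%N by rewrite card_sum card_ord.
  rewrite -card_ffun_on; apply: subset_leq_card; apply/fintype.subsetP => w.
  by rewrite inE => /andP[/forallP wH _]; apply/ffun_onP => a; rewrite !inE wH.
have bad_sum k : (N * \sum_q #|bad k q| <= (m * #|H1|) ^ (k + k) * N ^ m)%N.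
  apply: leq_trans (leq_mul (leW k) (leqnn _)); apply: first_moment => // w.
  by rewrite inE => /andP[_ /existsP].
(* With this weight, [Phi q < X] rules out every bad word and every collision
   in [H2]. *)
pose X := (2 * (m * #|P|) ^ 2).+1.
pose Phi q := (X * (\sum_(k < K.+1) #|bad k q| + #|collisions q H2|)
  + N * #|collisions q P|)%N.
(* The mean of [Phi] is at most [X / 2 + (m * #|P|) ^ 2], which is below [X]. *)
have [q qP] : exists q, (Phi q < X)%N.
  apply: contrapT => /forallNP/= noq.
  have : (N * (X * N ^ m) <= N * \sum_q Phi q)%N.
    rewrite leq_mul2l -[X in (_ * X ^ _)%N](card_ZN (prime_gt1 pN)).
    rewrite -[X in (_ ^ X)%N](card_ord m) -card_ffun mulnC -sum_nat_const.
    by apply/orP; right; apply: leq_sum => q _; rewrite leqNgt; apply/negP/noq.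
  rewrite /Phi big_split /= -!big_distrr /= big_split /=.
  rewrite exchange_big /=.
  set S1 := (\sum_(k < K.+1) \sum_q _)%N.
  have S1le : (N * S1 <= (\sum_(k < K.+1) (m * #|H1|) ^ (k + k)) * N ^ m)%N.
    rewrite /S1 big_distrr big_distrl /=; apply: leq_sum => k _; exact: bad_sum.
  have S2le := sum_collisions m H2 pN; have S3le := sum_collisions m P pN.
  have N0 : (0 < N ^ m)%N by rewrite expn_gt0 prime_gt0.
  move: S1 S1le S2le S3le Nlarge; rewrite /X.
  set Y1 := (\sum_(k < K.+1) (m * #|H1|) ^ (k + k))%N; set Y2 := ((m * #|H2|) ^ 2)%N.
  set S2 := (\sum_q #|collisions _ H2|)%N; set S3 := (\sum_q #|collisions _ P|)%N.
  move: Y1 Y2 S2 S3 => Y1 Y2 S2 S3 S1.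
  move: ((m * #|P|) ^ 2)%N => Y3; move: (N ^ m)%N N0 => T T0 h1 h2 h3 h4 h5.
  have k1 := leq_mul (leqnn (2 * Y3).+1) (leq_add h1 h2).
  have k2 := leq_mul (leqnn N) h3.
  have k3 : (N * (2 * Y3).+1 * T <= ((2 * Y3).+1 * (Y1 + Y2) + N * Y3) * T)%N by lia.
  move: k3; rewrite leq_pmul2r // => k3.
  have k4 := leq_mul (leqnn (2 * Y3).+1) h4.
  have := prime_gt0 pN; lia.
exists q; have bc0 : (\sum_(k < K.+1) #|bad k q| + #|collisions q H2|)%N = 0%N.
  by move: qP; rewrite /Phi; set a := (_ + #|collisions q H2|)%N; case: a => // a; lia.
move: qP bc0; rewrite /Phi => + /eqP; rewrite addn_eq0 => + /andP[/eqP b0 /eqP c0].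
rewrite b0 c0 muln0 add0n ltnS => ?; split=> //; last exact: cards0_eq.
move=> k kK w wH; rewrite word_valueE => w0.
rewrite inE; apply/andP; split; first exact/forallP.
apply/forallP => i; apply: contraPT b0 => wi; apply/eqP.
rewrite (bigD1 (Ordinal (kK : (k < K.+1)%N))) //= addn_eq0 negb_and; apply/orP; left.
rewrite -lt0n; apply/card_gt0P; exists w; rewrite !inE w0 eqxx andbT.
by apply/andP; split; [exact/forallP|apply/existsP; exists i].
Qed.

(** * Trigonometric sums *)

Lemma cos_pi4_sqr (R : realType) : cos (pi / 4) ^+ 2 = 1 / 2 :> R.
Proof.
have := cos2Dsin2 (pi / 4 : R); have := cos_pihalf R.
have -> : pi / 2 = pi / 4 + pi / 4 :> R by lra.
by rewrite cosD -!expr2; lra.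
Qed.

Lemma cos_ge_pi4 (R : realType) (x : R) :
  0 <= x <= pi / 4 -> 0 < cos (pi / 4 : R) /\ cos (pi / 4) <= cos x.
Proof.
move=> /andP[x0 x4]; have pi0 := pi_gt0 R; split.
  by apply: cos_gt0_pihalf; apply/andP; split; lra.
move: x4; rewrite le_eqVlt => /predU1P[->//|x4].
by apply: ltW; rewrite ltr_cos // in_itv /=; apply/andP; split; lra.
Qed.

(** [sin x = 2 sin (x / 2) cos (x / 2)], and the mean value theorem gives
    [sin (x / 2) = cos c * (x / 2)]. Both cosines are at least [cos (pi / 4)], so their product is
    at least 1/2. *)
Lemma sin_ge_half (R : realType) (x : R) : 0 <= x <= pi / 2 -> x / 2 <= sin x.
Proof.
move=> /andP[x0 x2].
have y0 : 0 <= x / 2 by lra.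
have [|c] := @MVT_segment _ sin cos _ _ y0.
  exact/continuous_subspaceT/continuous_sin.
rewrite in_itv /= sin0 !subr0 => /andP[c0 cy] sE.
have [k0 kc] : 0 < cos (pi / 4 : R) /\ cos (pi / 4) <= cos c.
  by apply: cos_ge_pi4; apply/andP; split; lra.
have [_ ky] : 0 < cos (pi / 4 : R) /\ cos (pi / 4) <= cos (x / 2).
  by apply: cos_ge_pi4; apply/andP; split; lra.
have -> : sin x = 2 * (cos c * cos (x / 2)) * (x / 2).
  have -> : sin x = sin (x / 2 + x / 2) by congr sin; lra.
  by rewrite sinD sE; ring.
have : 1 / 2 <= cos c * cos (x / 2).
  by rewrite -(cos_pi4_sqr R) expr2; apply: ler_pM => //; exact: ltW.
by nra.
Qed.

(** The modulus of [x + i y]; transforms are treated through their real and imaginary parts. *)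
Definition norm2 (R : realType) (x y : R) : R := Num.sqrt (x ^+ 2 + y ^+ 2).

Lemma norm2_ge0 (R : realType) (x y : R) : 0 <= norm2 x y.
Proof. exact: sqrtr_ge0. Qed.

Lemma norm2Z (R : realType) (a x y : R) :
  norm2 (a * x) (a * y) = `|a| * norm2 x y.
Proof. by rewrite /norm2 !exprMn -mulrDr sqrtrM ?sqr_ge0 // sqrtr_sqr. Qed.

Lemma norm2_ge (R : realType) (x y : R) : x <= norm2 x y.
Proof.
apply: le_trans (ler_norm x) _.
by rewrite -sqrtr_sqr ler_wsqrtr // lerDl sqr_ge0.
Qed.

Lemma norm2D (R : realType) (x y x' y' : R) :
  norm2 (x + x') (y + y') <= norm2 x y + norm2 x' y'.
Proof.
have n0 := addr_ge0 (norm2_ge0 x y) (norm2_ge0 x' y').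
rewrite -[leRHS]ger0_norm // -sqrtr_sqr ler_wsqrtr //.
have sq (u v : R) : norm2 u v ^+ 2 = u ^+ 2 + v ^+ 2.
  by rewrite sqr_sqrtr // addr_ge0 // sqr_ge0.
(* Cauchy-Schwarz: the squares of the two sides differ by [(x * y' - y * x') ^+ 2]. *)
have : x * x' + y * y' <= norm2 x y * norm2 x' y'.
  apply: le_trans (ler_norm _) _; rewrite -sqrtr_sqr -sqrtrM; last first.
    by rewrite addr_ge0 // sqr_ge0.
  rewrite ler_wsqrtr //.
  have := sqr_ge0 (x * y' - y * x'); nra.
have := sq x y; have := sq x' y'; nra.
Qed.

Lemma norm2_sum (R : realType) (I : finType) (P : pred I) (F G : I -> R) :
  norm2 (\sum_(i | P i) F i) (\sum_(i | P i) G i)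
    <= \sum_(i | P i) norm2 (F i) (G i).
Proof.
apply: (big_ind3 (fun x y z => norm2 x y <= z)) => //.
- by rewrite /norm2 expr0n /= addr0 sqrtr0.
- move=> x1 y1 z1 x2 y2 z2 h1 h2.
  exact: le_trans (norm2D _ _ _ _) (lerD h1 h2).
Qed.

Lemma norm2_cos_sin (R : realType) (x : R) : norm2 (cos x) (sin x) = 1.
Proof. by rewrite /norm2 cos2Dsin2 sqrtr1. Qed.

Lemma norm2_trig_sum (R : realType) (p : nat) (t : R) :
  `|sin (t / 2)| * norm2 (\sum_(1 <= i < p.+1) cos (i%:R * t))
                         (\sum_(1 <= i < p.+1) sin (i%:R * t)) <= 1.
Proof.
(* [2 * sin (t / 2) * e^(i * t)] telescopes. *)
pose u i : R := sin (i%:R * t - t / 2).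
pose v i : R := - cos (i%:R * t - t / 2).
have telC : 2 * sin (t / 2) * \sum_(1 <= i < p.+1) cos (i%:R * t) = u p.+1 - u 1%N.
  rewrite -telescope_sumr // mulr_sumr; apply: eq_bigr => i _; rewrite /u.
  have -> : i.+1%:R * t - t / 2 = i%:R * t + t / 2 by rewrite -natr1; lra.
  by rewrite sinD sinB; ring.
have telS : 2 * sin (t / 2) * \sum_(1 <= i < p.+1) sin (i%:R * t) = v p.+1 - v 1%N.
  rewrite -telescope_sumr // mulr_sumr; apply: eq_bigr => i _; rewrite /v.
  have -> : i.+1%:R * t - t / 2 = i%:R * t + t / 2 by rewrite -natr1; lra.
  by rewrite cosD cosB; ring.
have uv i : norm2 (u i) (v i) = 1.
  by rewrite /norm2 /u /v sqrrN addrC cos2Dsin2 sqrtr1.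
have uvN i : norm2 (- u i) (- v i) = 1 by have := uv i; rewrite /norm2 !sqrrN.
rewrite -(ler_pM2l (ltr0n R 2)) mulrA -{1}(ger0_norm (ler0n R 2)) -normrM -norm2Z.
rewrite telC telS; apply: le_trans (norm2D _ _ _ _) _; rewrite uv uvN; lra.
Qed.

(** * Fourier transforms *)

Lemma cos_periodic_nat (R : realType) (x : R) (n : nat) :
  cos (x + 2 * pi * n%:R) = cos x.
Proof.
by rewrite (mulr_natl pi 2) mulr_natr periodicn //; exact: cosD2pi.
Qed.

Lemma sin_periodic_nat (R : realType) (x : R) (n : nat) :
  sin (x + 2 * pi * n%:R) = sin x.
Proof.
by rewrite (mulr_natl pi 2) mulr_natr periodicn //; exact: sinD2pi.
Qed.

Definition zcos (R : realType) (N : nat) (z : 'Z_N) : R :=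
  cos (2 * pi * (val z)%:R / N%:R).
Definition zsin (R : realType) (N : nat) (z : 'Z_N) : R :=
  sin (2 * pi * (val z)%:R / N%:R).

(** Reducing [a] modulo [N] changes the angle by a multiple of [2 pi], so the additive character
    with parts [zcos] and [zsin] can be computed from any representative. *)
Lemma angle_mod (R : realType) (N a : nat) : (1 < N)%N ->
  2 * pi * a%:R / N%:R =
    2 * pi * (val (a%:R : 'Z_N))%:R / N%:R + 2 * pi * (a %/ N)%:R :> R.
Proof.
move=> N1; have N0 : N%:R != 0 :> R by rewrite pnatr_eq0; lia.
rewrite [val _]val_Zp_nat // {1}(divn_eq a N) natrD natrM; field.
by rewrite N0.
Qed.

Lemma zcos_nat (R : realType) (N a : nat) : (1 < N)%N ->
  zcos R (a%:R : 'Z_N) = cos (2 * pi * a%:R / N%:R).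
Proof. by move=> N1; rewrite (angle_mod R a N1) cos_periodic_nat. Qed.

Lemma zsin_nat (R : realType) (N a : nat) : (1 < N)%N ->
  zsin R (a%:R : 'Z_N) = sin (2 * pi * a%:R / N%:R).
Proof. by move=> N1; rewrite (angle_mod R a N1) sin_periodic_nat. Qed.

(** Real weights are allowed because a union of dilates is compared with the sum of their
    indicators, which exceeds 1 where they overlap. *)
Definition wfourier (R : realType) (N : nat) (f : 'Z_N -> R) (r : 'Z_N) : R :=
  norm2 (\sum_z f z * zcos R (z * r)) (\sum_z f z * zsin R (z * r)).

Definition ind (R : realType) (N : nat) (A : {set 'Z_N}) (z : 'Z_N) : R :=
  (z \in A)%:R.

Lemma sum_ind (R : realType) (N : nat) (A : {set 'Z_N}) (F : 'Z_N -> R) :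
  \sum_z ind R A z * F z = \sum_(z in A) F z.
Proof.
by rewrite [RHS]big_mkcond; apply: eq_bigr => z _; rewrite /ind;
  case: ifP; rewrite ?mul1r ?mul0r.
Qed.

Lemma fourier_abs_ind (R : realType) (N : nat) (A : {set 'Z_N}) (r : 'Z_N) :
  (1 < N)%N -> fourier_abs R A r = wfourier (ind R A) r.
Proof.
move=> N1; rewrite /wfourier !sum_ind /fourier_abs /norm2.
rewrite /fourier_re /fourier_im; congr (Num.sqrt (_ ^+ 2 + _ ^+ 2)).
  by apply: eq_bigr => n _; rewrite -zcos_nat // natrM !natr_Zp.
by apply: eq_bigr => n _; rewrite -zsin_nat // natrM !natr_Zp.
Qed.

Lemma wfourierD (R : realType) (N : nat) (f g : 'Z_N -> R) (r : 'Z_N) :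
  wfourier (fun z => f z + g z) r <= wfourier f r + wfourier g r.
Proof.
rewrite /wfourier; apply: le_trans (norm2D _ _ _ _); rewrite -!big_split /=.
by under eq_bigr do rewrite mulrDl;
  under [X in norm2 _ X]eq_bigr do rewrite mulrDl.
Qed.

Lemma wfourier_sum (R : realType) (N : nat) (I : finType) (P : pred I)
    (F : I -> 'Z_N -> R) (r : 'Z_N) :
  wfourier (fun z => \sum_(i | P i) F i z) r <= \sum_(i | P i) wfourier (F i) r.
Proof.
rewrite /wfourier; under eq_bigr do rewrite mulr_suml.
under [X in norm2 _ X]eq_bigr do rewrite mulr_suml.
by rewrite exchange_big [X in norm2 _ X]exchange_big; apply: norm2_sum.
Qed.

Lemma wfourier_le (R : realType) (N : nat) (f : 'Z_N -> R) (r : 'Z_N) :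
  wfourier f r <= \sum_z `|f z|.
Proof.
apply: le_trans (norm2_sum _ _ _) _; apply: ler_sum => z _.
by rewrite norm2Z norm2_cos_sin mulr1.
Qed.

Lemma wfourier_close (R : realType) (N : nat) (f g : 'Z_N -> R) (r : 'Z_N) :
  wfourier f r <= wfourier g r + \sum_z `|f z - g z|.
Proof.
have -> : wfourier f r = wfourier (fun z => g z + (f z - g z)) r.
  by congr wfourier; apply/funext => z; rewrite addrC subrK.
by apply: le_trans (wfourierD _ _ _) _; rewrite lerD2l wfourier_le.
Qed.

(** For a unit [q] this is the dilate [q^-1 P], written as a preimage. *)
Definition dilate_set (N : nat) (q : 'Z_N) (P : {set 'Z_N}) : {set 'Z_N} :=
  [set x | q * x \in P].

Lemma card_dilate_set (N : nat) (q : 'Z_N) (P : {set 'Z_N}) :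
  q \is a GRing.unit -> #|dilate_set q P| = #|P|.
Proof.
move=> uq; have inj : injective (fun x => q^-1 * x).
  by apply: mulrI; rewrite unitrV.
rewrite -[RHS](card_imset _ inj).
apply: eq_card => x; rewrite inE; apply/idP/imsetP => [xP|[y yP ->]].
  by exists (q * x); rewrite ?mulKr.
by rewrite mulVKr.
Qed.

(** Substituting [q^-1 * z] for [z] turns the dilate into [P] and cancels the factor [q] of the
    frequency. *)
Lemma wfourier_dilate (R : realType) (N : nat) (q r : 'Z_N) (P : {set 'Z_N}) :
  q \is a GRing.unit ->
  wfourier (ind R (dilate_set q P)) (q * r) = wfourier (ind R P) r.
Proof.
move=> uq; rewrite /wfourier.
have inj : injective (fun x => q^-1 * x).
  by apply: mulrI; rewrite unitrV.
rewrite (reindex_inj inj) [X in norm2 _ X](reindex_inj inj) /=.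
have E z : q^-1 * z * (q * r) = z * r by rewrite [q^-1 * z]mulrC -mulrA mulKr.
have E2 z : ind R (dilate_set q P) (q^-1 * z) = ind R P z.
  by rewrite /ind inE mulVKr.
by under eq_bigr do rewrite E E2; under [X in norm2 _ X]eq_bigr do rewrite E E2.
Qed.

(** Starting at 1 excludes 0, which would lie in every dilate; a point common to two dilates then
    gives a collision, whose first entry has to be nonzero. *)
Definition zinterval (N p : nat) : {set 'Z_N} := [set z : 'Z_N | (1 <= z <= p)%N].

Lemma big_zinterval (R : realType) (N p : nat) (F : nat -> R) : (p < N)%N ->
  (1 < N)%N -> \sum_(z in zinterval N p) F (val z) = \sum_(1 <= i < p.+1) F i.
Proof.
move=> pN N1; rewrite -(Zp_cast N1) in pN.
rewrite (big_nat_widen _ _ _ _ _ pN) big_geq_mkord.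
by apply: eq_bigl => z; rewrite inE /= andbC ltnS.
Qed.

Lemma card_zinterval (N p : nat) : (p < N)%N -> (1 < N)%N ->
  #|zinterval N p| = p.
Proof.
move=> pN N1; rewrite -sum1_card; rewrite -(Zp_cast N1) in pN.
rewrite [RHS](_ : p = \sum_(1 <= i < p.+1) 1)%N; last first.
  by rewrite sum_nat_const_nat subn1 muln1.
rewrite (big_nat_widen _ _ _ _ _ pN) big_geq_mkord.
by apply: eq_bigl => z; rewrite inE /= andbC ltnS.
Qed.

Lemma wfourier_zinterval (R : realType) (N p : nat) (t : 'Z_N) :
  (p < N)%N -> (1 < N)%N -> let th := 2 * pi * (val t)%:R / N%:R : R in
  wfourier (ind R (zinterval N p)) t =
  norm2 (\sum_(1 <= i < p.+1) cos (i%:R * th)) (\sum_(1 <= i < p.+1) sin (i%:R * th)).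
Proof.
move=> pN N1 th; rewrite /wfourier !sum_ind.
rewrite -!(big_zinterval _ pN N1).
have E (z : 'Z_N) : (val z)%:R * th = 2 * pi * (val z * val t)%:R / N%:R :> R.
  by rewrite /th natrM; ring.
congr norm2; apply: eq_bigr => z _; rewrite E -?zcos_nat -?zsin_nat //;
  by rewrite natrM !natr_Zp.
Qed.

(** The geometric sum is at most [1 / |sin (pi t / N)|], and this sine is at least [v / N] for [v]
    the distance from [t] to 0, because [sin x >= x / 2] and [pi >= 2]. The product form also covers
    [t = 0]. *)
Lemma wfourier_zinterval_le (R : realType) (N p : nat) (t : 'Z_N) :
  (p < N)%N -> (1 < N)%N ->
  wfourier (ind R (zinterval N p)) t * (minn t (N - t))%:R <= N%:R.
Proof.
move=> pN N1; rewrite wfourier_zinterval //.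
set th := 2 * pi * (val t)%:R / N%:R.
have N0 : 0 < N%:R :> R by rewrite ltr0n; lia.
have tN : (t < N)%N by have := ltn_ord t; rewrite [X in (_ < X)%N]Zp_cast.
have pi2 := pi_ge2 R.
have sin_ge : (minn t (N - t))%:R / N%:R <= `|sin (th / 2)|.
  have aux (v : nat) : (v * 2 <= N)%N -> v%:R / N%:R <= sin (pi * (v%:R / N%:R)) :> R.
    move=> vN; have [v0 v2] : 0 <= v%:R / N%:R :> R /\ v%:R / N%:R <= 1 / 2 :> R.
      split; first by rewrite divr_ge0 ?ler0n.
      by rewrite ler_pdivrMr // mulrAC ler_pdivlMr // mul1r -natrM ler_nat.
    have h : 0 <= pi * (v%:R / N%:R : R) <= pi / 2 by apply/andP; split; nra.
    by apply: le_trans (sin_ge_half h); nra.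
  apply: le_trans (ler_norm _).
  have [t2|t2] := leqP (t * 2) N.
    have -> : minn t (N - t) = t by lia.
    have -> : th / 2 = pi * ((val t)%:R / N%:R) by rewrite /th; field; lra.
    exact: aux.
  have -> : minn t (N - t) = (N - t)%N by lia.
  have -> : th / 2 = pi - pi * ((N - t)%:R / N%:R).
    by rewrite /th natrB 1?ltnW //; field; lra.
  rewrite sinB sinpi cospi mul0r sub0r mulN1r opprK; apply: aux; lia.
set n2 := norm2 _ _.
have := norm2_trig_sum p th; rewrite -/n2.
move=> le1; have n20 : 0 <= n2 by exact: norm2_ge0.
have : (minn t (N - t))%:R / N%:R * n2 <= 1.
  exact: le_trans (ler_wpM2r n20 sin_ge) le1.
by rewrite mulrAC ler_pdivrMr // mul1r mulrC.
Qed.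

(** As [8 * (p * s) <= N], all angles lie in [[0, pi / 4]], so the real part alone is at least
    [p * cos (pi / 4)]. *)
Lemma wfourier_zinterval_ge (R : realType) (N p s : nat) :
  (p < N)%N -> (1 < N)%N -> (8 * (p * s) <= N)%N ->
  7 / 10 * p%:R <= wfourier (ind R (zinterval N p)) (s%:R : 'Z_N).
Proof.
move=> pN N1 psN; rewrite wfourier_zinterval //; apply: le_trans (norm2_ge _ _).
have N0 : 0 < N%:R :> R by rewrite ltr0n; lia.
have pi0 := pi_gt0 R.
have [->|p0] := posnP p; first by rewrite mulr0 big_geq.
have sN : (s < N)%N by nia.
have -> : 7 / 10 * p%:R = \sum_(1 <= i < p.+1) (7 / 10 : R).
  by rewrite sumr_const_nat subn1 mulr_natr.
rewrite big_nat_cond [leRHS]big_nat_cond; apply: ler_sum => i /andP[/andP[i1 ip] _].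
rewrite [val _]val_Zp_nat // modn_small //.
have [c0 cE] : 0 < cos (pi / 4 : R) /\
    cos (pi / 4 : R) <= cos (i%:R * (2 * pi * s%:R / N%:R)).
  apply: cos_ge_pi4.
  have -> : i%:R * (2 * pi * s%:R / N%:R) = pi / 4 * ((8 * (i * s))%:R / N%:R) :> R.
    by rewrite !natrM; field; lra.
  rewrite mulr_ge0 ?divr_ge0 ?ler0n //=; last lra.
  apply: ler_piMr; first lra.
  by rewrite ler_pdivrMr // mul1r ler_nat; apply: leq_trans psN; nia.
by apply: le_trans cE; have := cos_pi4_sqr R; nra.
Qed.

(** * Unions of dilates *)

Definition dilate_union (N m : nat) (q : 'I_m -> 'Z_N) (P : {set 'Z_N}) :
  {set 'Z_N} := \bigcup_i dilate_set (q i) P.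

(** A point [z] common to the dilates [i] and [j] yields the collision
    [q i * (q j * z) = q j * (q i * z)], from which [z] is recovered since the factors are units. *)
Lemma sum_overlap_le (N m : nat) (q : 'I_m -> 'Z_N) (P : {set 'Z_N}) :
  (forall i, q i \is a GRing.unit) -> 0 \notin P ->
  (\sum_z #|[set x : 'I_m * 'I_m | [&& x.1 != x.2, z \in dilate_set (q x.1) P
      & z \in dilate_set (q x.2) P]]| <= #|collisions q P|)%N.
Proof.
move=> uq P0.
pose T := [set y : 'Z_N * ('I_m * 'I_m) | [&& y.2.1 != y.2.2,
  y.1 \in dilate_set (q y.2.1) P & y.1 \in dilate_set (q y.2.2) P]].
pose g (y : 'Z_N * ('I_m * 'I_m)) := (y.2, (q y.2.2 * y.1, q y.2.1 * y.1)).
have inj : injective g.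
  move=> [z [i j]] [z' [i' j']] E.
  have /= Ei := congr1 (fun u => u.1.1) E; have /= Ej := congr1 (fun u => u.1.2) E.
  have /= Ez := congr1 (fun u => u.2.2) E.
  by rewrite -Ei -Ej in Ez *; rewrite (mulrI (uq i) Ez).
apply: (@leq_trans #|T|).
  rewrite -[leqRHS]sum1_card (partition_big (fun y => y.1) predT) //=.
  apply: leq_sum => z _; rewrite -sum1_card.
  rewrite (reindex_onto (fun x => (z, x)) (fun y => y.2)) /=; last first.
    by move=> [z' x] /= /andP[_ /eqP ->].
  by apply: eq_leq; apply: eq_bigl => x; rewrite !inE /= !eqxx !andbT.
rewrite -(card_imset _ inj); apply: subset_leq_card.
apply/fintype.subsetP => _ /imsetP[[z [i j]] + ->].
rewrite !inE /= => /and3P[-> zi zj]; rewrite zi zj /= mulrCA eqxx andbT.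
by apply: contra P0 => /eqP <-.
Qed.

(** A point in [c > 0] dilates contributes [c - 1]. Fixing one of these dilates and pairing it with
    the others shows that this is at most the number of ordered pairs of distinct dilates containing
    the point. *)
Lemma dilate_union_close (R : realType) (N m : nat) (q : 'I_m -> 'Z_N)
    (P : {set 'Z_N}) :
  (forall i, q i \is a GRing.unit) -> 0 \notin P ->
  \sum_z `|ind R (dilate_union q P) z - \sum_i ind R (dilate_set (q i) P) z|
    <= #|collisions q P|%:R.
Proof.
move=> uq P0; apply: le_trans (_ : _ <= _%:R) _; last first.
  by rewrite ler_nat; exact: sum_overlap_le uq P0.
rewrite natr_sum; apply: ler_sum => z _.
set E := [set x | _].
pose C := [set i | z \in dilate_set (q i) P].
have -> : \sum_i ind R (dilate_set (q i) P) z = #|C|%:R.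
  rewrite /ind -natr_sum -sum1_card [in RHS]big_mkcond; congr (_%:R).
  by apply: eq_bigr => i _; rewrite [in RHS]inE; case: (z \in _).
rewrite /ind; have [/bigcupP[i _ zi]|/negP zA] := boolP (z \in dilate_union q P).
  have iC : i \in C by rewrite inE.
  have := cardsD1 i C; rewrite iC => ->.
  rewrite natrD opprD addrA subrr sub0r normrN normr_nat ler_nat.
  have inj : injective (fun j : 'I_m => (i, j)) by move=> j j' [].
  rewrite -(card_imset _ inj); apply: subset_leq_card.
  apply/fintype.subsetP => _ /imsetP[j + ->].
  rewrite inE in zi; by rewrite !inE /= zi => /andP[ji ->]; rewrite eq_sym ji.
have -> : #|C| = 0%N.
  apply: eq_card0 => i; rewrite inE; apply/negP => zi; apply: zA.
  by apply/bigcupP; exists i.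
by rewrite subrr normr0 ler0n.
Qed.

Lemma card_dilate_union (R : realType) (N m : nat) (q : 'I_m -> 'Z_N)
    (P : {set 'Z_N}) :
  (forall i, q i \is a GRing.unit) -> 0 \notin P ->
  `|#|dilate_union q P|%:R - (m * #|P|)%:R| <= #|collisions q P|%:R :> R.
Proof.
move=> uq P0; apply: le_trans (dilate_union_close R uq P0).
apply: le_trans (ler_norm_sum _ _ _); rewrite sumrB exchange_big /=.
have sumE (B : {set 'Z_N}) : \sum_z ind R B z = #|B|%:R.
  by rewrite /ind -natr_sum -sum1_card [in RHS]big_mkcond; congr (_%:R).
rewrite sumE (eq_bigr (fun=> #|P|%:R)) => [|i _].
  by rewrite sumr_const card_ord natrM mulr_natl.
by rewrite sumE card_dilate_set.
Qed.

Lemma wfourierN (R : realType) (N : nat) (f : 'Z_N -> R) (r : 'Z_N) :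
  wfourier (fun z => - f z) r = wfourier f r.
Proof.
rewrite /wfourier -[RHS]mul1r -(normrN1 R) -norm2Z !mulN1r -!sumrN.
by congr norm2; apply: eq_bigr => z _; rewrite mulNr.
Qed.

Lemma wfourier_zinterval_tail (R : realType) (N p M : nat) (t : 'Z_N) :
  (p < N)%N -> (1 < N)%N -> t \notin zball N M ->
  wfourier (ind R (zinterval N p)) t <= N%:R / M.+1%:R.
Proof.
move=> pN N1; rewrite inE -ltnNge => Mt; rewrite ler_pdivlMr //.
apply: le_trans (wfourier_zinterval_le R t pN N1).
by apply: ler_wpM2l; [exact: norm2_ge0|rewrite ler_nat].
Qed.

Lemma sum_tail_le (R : realType) (N m p M : nat) (q : 'I_m -> 'Z_N)
    (i : 'I_m) (r : 'Z_N) :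
  (p < N)%N -> (1 < N)%N -> (forall j, q j \is a GRing.unit) ->
  (forall j, j != i -> (q j)^-1 * r \notin zball N M) ->
  \sum_(j | j != i) wfourier (ind R (dilate_set (q j) (zinterval N p))) r
    <= m%:R * (N%:R / M.+1%:R).
Proof.
move=> pN N1 uq far.
have c0 : 0 <= N%:R / M.+1%:R :> R by rewrite divr_ge0 ?ler0n.
apply: (@le_trans _ _ (\sum_(j : 'I_m | j != i) N%:R / M.+1%:R)).
  apply: ler_sum => j ji; rewrite -[r in X in X <= _](mulVKr (uq j)).
  by rewrite wfourier_dilate // wfourier_zinterval_tail // far.
rewrite [leRHS]mulr_natl -[X in _ <= _ *+ X](card_ord m) -sumr_const.
by rewrite [leRHS](bigD1 i) //= lerDr.
Qed.

Lemma no_collision (N m M : nat) (q : 'I_m -> 'Z_N) (i j : 'I_m) (s t : 'Z_N) :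
  collisions q (zball N M) = finset.set0 -> s \in zball N M ->
  t \in zball N M -> s != 0 -> q i * s = q j * t -> i = j.
Proof.
move=> c0 sM tM s0 E; apply: contrapT => /eqP ij.
have : ((i, j), (s, t)) \in collisions q (zball N M).
  by rewrite inE /= ij sM tM s0 E eqxx.
by rewrite c0 inE.
Qed.

(** Without collisions at most one quotient [(q i)^-1 * r] lies in the ball. That [i] is chosen, or
    any [i] if there is none; all other dilates contribute tails, and passing from the union to the
    sum costs the overlap. *)
Lemma wfourier_union_le (R : realType) (N m p M : nat) (q : 'I_m -> 'Z_N)
    (r : 'Z_N) :
  (p < N)%N -> (1 < N)%N -> (0 < m)%N -> (forall j, q j \is a GRing.unit) ->
  collisions q (zball N M) = finset.set0 -> r != 0 ->
  exists i, wfourier (ind R (dilate_union q (zinterval N p))) r <=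
    wfourier (ind R (zinterval N p)) ((q i)^-1 * r)
      + m%:R * (N%:R / M.+1%:R) + #|collisions q (zinterval N p)|%:R.
Proof.
move=> pN N1 m0 uq c0 r0; set P := zinterval N p.
have P0 : 0 \notin P by rewrite inE.
have [i far] : exists i, forall j, j != i -> (q j)^-1 * r \notin zball N M.
  case: (pickP (fun i => (q i)^-1 * r \in zball N M)) => [i ri|none]; last first.
    by exists (Ordinal m0) => j _; rewrite none.
  exists i => j ji; apply/negP => rj; move/eqP: ji; apply.
  apply: (no_collision c0 rj ri); last by rewrite !mulVKr.
  apply: contra r0 => /eqP E.
  by rewrite -[r](mulVKr (uq j)) E mulr0.
exists i; apply: le_trans (wfourier_close _
  (fun z => \sum_i ind R (dilate_set (q i) P) z) _) _.
apply: lerD; last exact: dilate_union_close.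
apply: le_trans (wfourier_sum _ _ _) _.
rewrite (bigD1 i) //=; apply: lerD; last exact: sum_tail_le.
by rewrite -[r in X in X <= _](mulVKr (uq i)) wfourier_dilate.
Qed.

(** The indicator of the dilate [i] is the sum of all of them minus the others. The sum is the union
    up to the overlap, and the others contribute only tails at the frequency [q i * s]. *)
Lemma wfourier_union_ge (R : realType) (N m p M : nat) (q : 'I_m -> 'Z_N)
    (i : 'I_m) (s : 'Z_N) :
  (p < N)%N -> (1 < N)%N -> (forall j, q j \is a GRing.unit) ->
  collisions q (zball N M) = finset.set0 -> s != 0 -> s \in zball N M ->
  wfourier (ind R (zinterval N p)) s <=
    wfourier (ind R (dilate_union q (zinterval N p))) (q i * s)
      + m%:R * (N%:R / M.+1%:R) + #|collisions q (zinterval N p)|%:R.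
Proof.
move=> pN N1 uq c0 s0 sM; set P := zinterval N p.
have P0 : 0 \notin P by rewrite inE.
have far j : j != i -> (q j)^-1 * (q i * s) \notin zball N M.
  move=> ji; apply/negP => rj; move/eqP: ji; apply; apply: esym.
  by apply: (no_collision c0 sM rj s0); rewrite mulVKr.
rewrite -(wfourier_dilate R s P (uq i)).
have -> : ind R (dilate_set (q i) P) = fun z =>
    \sum_j ind R (dilate_set (q j) P) z +
      - \sum_(j | j != i) ind R (dilate_set (q j) P) z.
  by apply/funext => z; rewrite (bigD1 i) //= addrK.
apply: le_trans (wfourierD _ _ _) _; rewrite wfourierN addrAC; apply: lerD.
  apply: le_trans (wfourier_close _ (ind R (dilate_union q P)) _) _.
  rewrite lerD2l; under eq_bigr do rewrite distrC.
  exact: dilate_union_close.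
by apply: le_trans (wfourier_sum _ _ _) _; exact: sum_tail_le.
Qed.

(** * Choice of the parameters *)

Lemma pow_le_of_log2 (R : realType) (k : nat) (x y : R) :
  0 < x -> 0 < y -> k%:R * log2 x <= log2 y -> x ^+ k <= y.
Proof.
move=> x0 y0; have l2 : 0 < ln (2 : R) by rewrite ln_gt0 // ltr1n.
rewrite /log2 mulrA ler_pM2r ?invr_gt0 // mulr_natl -lnXn // ler_ln // posrE //.
exact: exprn_gt0.
Qed.

(** This is [k <= log2 (delta^-1) / 2] exponentiated; it later makes the words with several indices
    negligible. *)
Lemma admissible_pow2 (R : realType) (N k : nat) (delta alpha : R) :
  0 < delta -> admissible_k N delta alpha k -> 2 ^+ (k + k) * delta <= 1.
Proof.
move=> d0 [_ [kle _]]; rewrite -ler_pdivlMr // mul1r.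
apply: pow_le_of_log2 => //; first by rewrite invr_gt0.
have -> : log2 (2 : R) = 1 by rewrite /log2 divff // gt_eqF // ln_gt0 // ltr1n.
by rewrite natrD mulr1; lra.
Qed.

Lemma admissible_pow (R : realType) (N k : nat) (delta alpha : R) :
  (0 < N)%N -> 0 < delta -> 0 < alpha -> admissible_k N delta alpha k ->
  (64 * k%:R * (delta / alpha ^+ 2)) ^+ (k + k) <= N%:R.
Proof.
move=> N0 d0 a0 [k2 [_ le]].
have k0 : 0 < k%:R :> R by rewrite ltr0n; lia.
apply: pow_le_of_log2; rewrite ?ltr0n //.
  by rewrite mulr_gt0 ?divr_gt0 ?mulr_gt0 ?exprn_gt0.
apply: le_trans le; rewrite natrD -mulr2n -[X in X * log2 _]mulr_natl.
apply: ler_wpM2l; first by rewrite mulr_ge0 // ltW.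
have -> : 64 * k%:R * (delta / alpha ^+ 2) = 2 ^+ 6 * delta * k%:R / alpha ^+ 2.
  by field; rewrite gt_eqF.
by rewrite le_max lexx.
Qed.

(** With [y = delta / alpha ^+ 2], the two left sides are four times the bounds for the numbers of
    words and of possible collisions, so each may fill a quarter of [N]. *)
Lemma power_room (R : realFieldType) (K : nat) (y : R) : 1 <= y -> (2 <= K)%N ->
  4 * (10 * y) ^+ (K + K) <= (64 * K%:R * y) ^+ (K + K) /\
  4 * (1156 * y ^+ 4) <= (64 * K%:R * y) ^+ (K + K).
Proof.
move=> y1 K2; have K4 : (4 <= K + K)%N by rewrite -[4%N]/(2 + 2)%N leq_add.
have K1 : 2 <= K%:R :> R by rewrite ler_nat.
have Ky : 20 * y <= 64 * K%:R * y by apply: ler_wpM2r; lra.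
have y0 : 0 <= y by lra.
have Ky0 : 0 <= 64 * K%:R * y by lra.
split.
  apply: (@le_trans _ _ ((2 : R) ^+ (K + K) * (10 * y) ^+ (K + K))).
    apply: ler_wpM2r; first by rewrite exprn_ge0 // mulr_ge0.
    have -> : 4 = (2 : R) ^+ 2 by ring.
    by apply: ler_weXn2l (leq_trans _ K4); rewrite ?ler1n.
  by rewrite -exprMn mulrA lerXn2r // ?nnegrE ?mulr_ge0 //; lra.
have -> : 4 * (1156 * y ^+ 4) = (68 * y ^+ 2) ^+ 2 by ring.
apply: (@le_trans _ _ (((16 * y) ^+ 2) ^+ 2)).
  rewrite lerXn2r // ?nnegrE ?sqr_ge0 //; first by rewrite mulr_ge0 // sqr_ge0.
  have -> : (16 * y) ^+ 2 = 256 * y ^+ 2 by ring.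
  by apply: ler_wpM2r; [exact: sqr_ge0|lra].
rewrite -exprM; apply: (@le_trans _ _ ((64 * K%:R * y) ^+ 4)).
  by rewrite lerXn2r // ?nnegrE ?mulr_ge0 //; lra.
by apply: ler_weXn2l K4; lra.
Qed.

(** The balls have at most [5 / alpha] and [34 * m / alpha] elements, as [alpha^-1 >= 8] absorbs the
    rounding. Multiplied by [m] this gives [5 * y] and [34 * y ^+ 2]. *)
Lemma room_for_generic (R : realType) (N K m L M : nat) (delta alpha : R) :
  (1 < N)%N -> 0 < alpha -> 32 * delta ^+ 2 <= alpha -> alpha <= delta / 4 ->
  (2 <= K)%N -> (0 < m)%N -> m%:R <= delta / alpha -> L%:R <= 2 / alpha ->
  M%:R <= 16 * m%:R / alpha ->
  (64 * K%:R * (delta / alpha ^+ 2)) ^+ (K + K) <= N%:R ->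
  (2 * (\sum_(k < K.+1) (m * #|zball N L|) ^ (k + k)
     + (m * #|zball N M|) ^ 2) <= N)%N.
Proof.
move=> N1 a0 h1 h2 K2 m0 mle Lle Mle Nge.
have d0 : 0 < delta by lra.
have d1 : delta <= 1 / 2 by nra.
have a1 : alpha <= 1 / 8 by lra.
set y := delta / alpha ^+ 2 in Nge.
have y1 : 1 <= y.
  by rewrite /y ler_pdivlMr ?exprn_gt0 // expr2; nra.
have m1 : 1 <= m%:R :> R by rewrite ler1n.
have ia : 8 <= alpha^-1.
  by rewrite -div1r ler_pdivlMr //; lra.
have aia : alpha * alpha^-1 = 1 by rewrite divff // gt_eqF.
have yE : y = delta / alpha * alpha^-1 by rewrite /y expr2; field; rewrite gt_eqF.
have card1 : (m * #|zball N L|)%:R <= 5 * y.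
  rewrite natrM yE.
  have : #|zball N L|%:R <= 5 * alpha^-1.
    apply: (@le_trans _ _ (2 * L.+1)%:R); first by rewrite ler_nat card_zball.
    by rewrite natrM -natr1; lra.
  have : 0 <= #|zball N L|%:R :> R by []. nra.
have card2 : (m * #|zball N M|)%:R <= 34 * (y ^+ 2).
  rewrite natrM.
  have c : #|zball N M|%:R <= 34 * (m%:R * alpha^-1).
    apply: (@le_trans _ _ (2 * M.+1)%:R); first by rewrite ler_nat card_zball.
    by rewrite natrM -natr1; nra.
  have c0 : 0 <= #|zball N M|%:R :> R by [].
  have : m%:R * #|zball N M|%:R <= m%:R * (34 * (m%:R * alpha^-1)).
    by apply: ler_wpM2l => //; lra.
  move=> /le_trans; apply.
  have mm : m%:R * m%:R <= (delta / alpha) * (delta / alpha) by apply: ler_pM => //; lra.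
  have -> : m%:R * (34 * (m%:R * alpha^-1)) = 34 * (m%:R * m%:R * alpha^-1) by ring.
  have -> : y ^+ 2 = (delta / alpha) * (delta / alpha) * alpha^-1 * alpha^-1.
    by rewrite yE; ring.
  apply: ler_wpM2l => //.
  apply: (@le_trans _ _ (delta / alpha * (delta / alpha) * alpha^-1)).
    by apply: ler_wpM2r => //; lra.
  apply: ler_peMr; last lra.
  by apply: mulr_ge0; [apply: mulr_ge0|]; lra.
rewrite -(ler_nat R); apply: le_trans Nge; rewrite natrM natrD natr_sum.
(* There are [K.+1 <= 2 ^ (K + K)] terms, each at most [(5 * y) ^+ (K + K)]. *)
have sum1 : \sum_(k < K.+1) ((m * #|zball N L|) ^ (k + k))%:R <= (10 * y) ^+ (K + K).
  have -> : (10 * y) ^+ (K + K) = 2 ^+ (K + K) * (5 * y) ^+ (K + K).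
    by rewrite -exprMn; congr (_ ^+ _); ring.
  apply: (@le_trans _ _ (\sum_(k < K.+1) (5 * y) ^+ (K + K))).
    apply: ler_sum => k _; rewrite natrX.
    apply: (@le_trans _ _ ((5 * y) ^+ (k + k))).
      by rewrite lerXn2r // ?nnegrE ?ler0n //; lra.
    apply: ler_weXn2l; first lra.
    by rewrite leq_add // -ltnS.
  rewrite sumr_const card_ord -[leLHS]mulr_natl; apply: ler_wpM2r.
    by apply: exprn_ge0; lra.
  rewrite -natrX ler_nat; apply: leq_trans (ltn_expl K (isT : (1 < 2)%N)) _.
  by rewrite leq_exp2l // leq_addr.
have sum2 : ((m * #|zball N M|) ^ 2)%:R <= 1156 * y ^+ 4.
  rewrite natrX; apply: (@le_trans _ _ ((34 * y ^+ 2) ^+ 2)).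
    by rewrite lerXn2r // ?nnegrE ?ler0n //; have := sqr_ge0 y; lra.
  by rewrite exprMn -exprM; lra.
have [big1 big2] := power_room y1 K2.
by lra.
Qed.

(** In units of [alpha * N], overlaps cost at most 2/7 and tails 1/16. A nonzero frequency in the
    spectrum thus leaves at least 1/2 for the transform of [P], which puts the quotient within
    [2 / alpha] of 0; conversely [7 / 10 * 2] minus both errors is still at least 1. *)
Lemma dilate_union_spectrum (R : realType) (N m p L M : nat)
    (delta alpha : R) (q : 'I_m -> 'Z_N) :
  let P := zinterval N p in let A := dilate_union q P in
  (1 < N)%N -> (p < N)%N -> 0 < alpha -> 32 * delta ^+ 2 <= alpha ->
  alpha <= delta / 4 -> m%:R <= delta / alpha < m.+1%:R ->
  2 * (alpha * N%:R) <= p%:R <= 17 / 8 * (alpha * N%:R) ->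
  2 / alpha < L.+1%:R -> 16 * m%:R / alpha < M.+1%:R ->
  (forall i, q i \is a GRing.unit) ->
  collisions q (zball N M) = finset.set0 ->
  (N * #|collisions q P| <= 2 * (m * p) ^ 2)%N ->
  [/\ delta * N%:R <= #|A|%:R, #|A|%:R <= 3 * delta * N%:R,
      forall r, r \in large_spectrum alpha A ->
        exists i, exists2 s, s \in zball N L & r = q i * s &
      forall i s, s \in zball N M -> s != 0 ->
        7 / 10 * p%:R <= wfourier (ind R P) s ->
        q i * s \in large_spectrum alpha A].
Proof.
move=> P A N1 pN a0 h1 h2 /andP[m1 m2] /andP[p1 p2] Lgt Mgt uq c0 cP.
have d0 : 0 < delta by lra.
have N0 : 0 < N%:R :> R by rewrite ltr0n ltnW.
have aN0 : 0 < alpha * N%:R by rewrite mulr_gt0.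
have dN0 : 0 < delta * N%:R by rewrite mulr_gt0.
have cardP : #|P| = p by exact: card_zinterval.
have P0 : 0 \notin P by rewrite inE.
have m4 : 4 <= delta / alpha by rewrite ler_pdivlMr //; lra.
have m3 : (3 < m)%N by rewrite -(ltr_nat R); rewrite -natr1 in m2; lra.
have m0 : (0 < m)%N by apply: ltn_trans m3.
(* [delta / alpha < m + 1 <= 5 / 4 * m] because [m >= 4]. *)
have m45 : 4 / 5 * (delta / alpha) <= m%:R.
  have : 4 <= m%:R :> R by rewrite ler_nat.
  by rewrite -natr1 in m2; lra.
have ma : m%:R * alpha <= delta by rewrite -ler_pdivlMr.
have ma45 : 4 / 5 * delta <= m%:R * alpha.
  by rewrite -ler_pdivrMr //; move: m45; rewrite mulrA.
have mp1 : 8 / 5 * (delta * N%:R) <= (m * p)%:R.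
  rewrite natrM; apply: (@le_trans _ _ (m%:R * (2 * (alpha * N%:R)))).
    by have := ler_wpM2r (ltW N0) ma45; lra.
  by apply: ler_wpM2l.
have mp2 : (m * p)%:R <= 17 / 8 * (delta * N%:R).
  rewrite natrM; apply: (@le_trans _ _ (m%:R * (17 / 8 * (alpha * N%:R)))).
    by apply: ler_wpM2l.
  by have := ler_wpM2r (ltW N0) ma; lra.
set D := #|collisions q P|%:R : R.
(* The overlap is at most [2 * (17 / 8) ^+ 2 * delta ^+ 2 * N], and [delta ^+ 2 <= alpha / 32]. *)
have Dle : D <= 2 / 7 * (alpha * N%:R).
  have : N%:R * D <= 2 * (17 / 8 * (delta * N%:R)) ^+ 2.
    rewrite /D -natrM; apply: (@le_trans _ _ (2 * (m * p) ^ 2)%:R).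
      by rewrite ler_nat.
    by rewrite natrM ler_wpM2l // natrX lerXn2r // nnegrE; lra.
  have -> : 2 * (17 / 8 * (delta * N%:R)) ^+ 2 =
    N%:R * (2 * (17 / 8) ^+ 2 * (delta ^+ 2) * N%:R) by ring.
  rewrite ler_pM2l // => /le_trans; apply.
  have := ler_wpM2r (ltW N0) h1; lra.
have Dad : alpha * N%:R <= 1 / 4 * (delta * N%:R).
  by have := ler_wpM2r (ltW N0) h2; lra.
have tail : m%:R * (N%:R / M.+1%:R) <= 1 / 16 * (alpha * N%:R).
  rewrite mulrA ler_pdivrMr ?ltr0n //.
  have := Mgt; rewrite ltr_pdivrMr // => /ltW/(ler_wpM2r (ltW N0)); lra.
set T := m%:R * _ in tail.
have /ler_normlP[A1 A2] := card_dilate_union R uq P0.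
rewrite cardP -/A -/D in A1 A2.
split; [lra|lra| |].
  move=> r; rewrite inE fourier_abs_ind // => rR.
  have [->|r0] := eqVneq r 0.
    exists (Ordinal m0), 0; last by rewrite mulr0.
    by rewrite inE min0n.
  have [i] := wfourier_union_le R pN N1 m0 uq c0 r0.
  rewrite -/P -/A -/D -/T => rle; exists i, ((q i)^-1 * r); last by rewrite mulVKr.
  have big : 1 / 2 * (alpha * N%:R) <= wfourier (ind R P) ((q i)^-1 * r).
    by move: D T Dle tail {A1 A2} rle => D T; lra.
  have := wfourier_zinterval_le R ((q i)^-1 * r) pN N1; rewrite -/P inE.
  set v := minn _ _ => vle; rewrite -ltnS -(ltr_nat R).
  apply: le_lt_trans Lgt; rewrite ler_pdivlMr //.
  have : 1 / 2 * (alpha * N%:R) * v%:R <= N%:R.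
    by apply: le_trans vle; apply: ler_wpM2r.
  have -> : 1 / 2 * (alpha * N%:R) * v%:R = N%:R * (v%:R * alpha / 2) by field.
  rewrite -[leRHS]mulr1 ler_pM2l //; lra.
move=> i s sM s0 sP; rewrite inE fourier_abs_ind //.
have := wfourier_union_ge R i pN N1 uq c0 s0 sM.
by rewrite -/P -/A -/D -/T; move: D T Dle tail {A1 A2} => D T; lra.
Qed.

(** Rounding down costs [m] a factor of at most 4/5 and [S] one of at most 16/17, and
    [4 / 5 * (1 / 36)] still exceeds 1/64. *)
Lemma spectrum_count_ge (R : realFieldType) (m S : nat) (delta alpha : R) :
  0 < delta -> 0 < alpha -> (4 <= m)%N -> (16 <= S)%N ->
  delta / alpha < m.+1%:R -> 1 / (32 * alpha) < S.+1%:R ->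
  delta / (64 * alpha ^+ 2) <= (m * S)%:R.
Proof.
move=> d0 a0 m4 S16; rewrite -(natr1 m) -(natr1 S) => m2 S2; rewrite natrM.
have ma45 : 4 / 5 * (delta / alpha) <= m%:R.
  by have : 4 <= m%:R :> R; [rewrite ler_nat|lra].
have S45 : 1 / 36 * alpha^-1 <= S%:R.
  have : 16 <= S%:R :> R by rewrite ler_nat.
  have E : 1 / (32 * alpha) = 1 / 32 * alpha^-1 by field; rewrite gt_eqF.
  by rewrite E in S2; lra.
have -> : delta / (64 * alpha ^+ 2) = 1 / 64 * (delta / alpha * alpha^-1).
  by field; rewrite gt_eqF.
have ia0 : 0 < alpha^-1 by rewrite invr_gt0.
have da0 : 0 < delta / alpha by rewrite mulr_gt0.
apply: (@le_trans _ _ (4 / 5 * (delta / alpha) * (1 / 36 * alpha^-1))).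
  by have := mulr_gt0 da0 ia0; lra.
by apply: ler_pM => //; lra.
Qed.

(** [2 ^+ (14 * k)] is [128 ^+ (k + k)], and [m <= delta / alpha] supplies the remaining power of
    [alpha^-1]. *)
Lemma word_count_le (R : realFieldType) (m k : nat) (delta alpha : R) :
  0 < alpha -> 0 <= delta -> m%:R <= delta / alpha -> (0 < k)%N ->
  2 * m%:R * (5 * alpha^-1) ^+ (k + k).-1
    <= 2 ^+ (14 * k) * delta / alpha ^+ (2 * k).
Proof.
move=> a0 d0 m1 k0; have ia0 : 0 < alpha^-1 by rewrite invr_gt0.
have -> : 2 ^+ (14 * k) * delta / alpha ^+ (2 * k) =
    (128 * alpha^-1) ^+ (k + k) * delta.
  have -> : (14 * k = 7 * (k + k))%N by rewrite addnn -mul2n mulnA.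
  have -> : (2 * k = k + k)%N by rewrite mul2n addnn.
  have e7 : (2 : R) ^+ 7 = 128 by ring.
  by rewrite [in RHS]exprMn [in RHS]exprVn exprM e7 mulrAC.
have -> : (128 * alpha^-1) ^+ (k + k) =
    128 * alpha^-1 * (128 * alpha^-1) ^+ (k + k).-1.
  by rewrite -exprS prednK // addn_gt0 k0.
have e0 : 0 <= (128 * alpha^-1) ^+ (k + k).-1.
  by rewrite exprn_ge0 // mulr_ge0 // ltW.
have le1 : (5 * alpha^-1) ^+ (k + k).-1 <= (128 * alpha^-1) ^+ (k + k).-1.
  by rewrite lerXn2r // ?nnegrE ?mulr_ge0 ?ltW // ltr_pM2r // ltr_nat.
apply: (@le_trans _ _ (2 * (delta / alpha) * (128 * alpha^-1) ^+ (k + k).-1)).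
  apply: ler_pM => //; last by apply: ler_wpM2l.
  by rewrite exprn_ge0 // mulr_ge0 // ltW.
have -> : 128 * alpha^-1 * (128 * alpha^-1) ^+ (k + k).-1 * delta =
    128 * (delta / alpha) * (128 * alpha^-1) ^+ (k + k).-1 by ring.
apply: ler_wpM2r => //; apply: ler_wpM2r; first by rewrite divr_ge0 // ltW.
by rewrite ler_nat.
Qed.

Theorem theorem16 (R : realType) (N : nat) (delta alpha : R) :
  prime N ->
  0 < delta -> delta <= 1 -> 0 < alpha -> alpha <= 1 ->
  32 * delta ^+ 2 <= alpha -> alpha <= delta / 4 ->
  (exists k : nat, admissible_k N delta alpha k) ->
  exists A : {set 'Z_N},
    [/\ delta * N%:R <= (#|A|%:R : R),
        (#|A|%:R : R) <= 3 * delta * N%:R,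
        delta / (64 * alpha ^+ 2) <= (#|large_spectrum alpha A|%:R : R) &
        forall k : nat, admissible_k N delta alpha k ->
          ((additive_energy k (large_spectrum alpha A))%:R : R)
            <= 2 ^+ (14 * k) * delta / alpha ^+ (2 * k)].
Proof.
move=> pN d0 _ a0 _ h1 h2 exk.
have lt_aux (a b n : nat) : (1 < n)%N -> (0 < b)%N -> (8 * (b * a) <= n)%N -> (a < n)%N.
  by nia.
have N1 := prime_gt1 pN.
have [K Kadm Kmax] : exists2 K, admissible_k N delta alpha K &
    forall k, admissible_k N delta alpha k -> (k <= K)%N.
  have exb : exists k, `[< admissible_k N delta alpha k >].
    by have [k kP] := exk; exists k; apply/asboolP.
  (* Admissible values are bounded since [k <= 2 ^ (k + k) <= delta^-1]. *)
  have bound k : `[< admissible_k N delta alpha k >] ->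
      (k <= Num.trunc delta^-1)%N.
    move=> /asboolP kP; rewrite truncn_ge_nat; last by rewrite invr_ge0 ltW.
    have := admissible_pow2 d0 kP; rewrite -ler_pdivlMr // mul1r.
    apply: le_trans; rewrite -natrX ler_nat.
    apply: leq_trans (ltnW (ltn_expl k (isT : (1 < 2)%N))) _.
    by rewrite leq_exp2l // leq_addr.
  case: (ex_maxnP exb bound) => K /asboolP KP Kmax; exists K => // k kP.
  by apply: Kmax; apply/asboolP.
have K2 : (2 <= K)%N by case: Kadm.
have d1 : delta <= 1 / 128 by nra.
have ia : 8 <= alpha^-1.
  by rewrite -div1r ler_pdivlMr //; lra.
have Nge := admissible_pow (ltnW N1) d0 a0 Kadm.
(* Rounding [2 * alpha * N] up to the integer [p] then adds at most [alpha * N / 8]. *)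
have aN : 8 <= alpha * N%:R.
  have K2' : 2 <= K%:R :> R by rewrite ler_nat.
  have b : 64 * alpha^-1 <= 64 * K%:R * (delta / alpha ^+ 2).
    have -> : 64 * K%:R * (delta / alpha ^+ 2) =
        64 * (K%:R * (delta * alpha^-1)) * alpha^-1.
      by field; rewrite gt_eqF.
    have da : 4 <= delta * alpha^-1 by rewrite ler_pdivlMr //; lra.
    have Kda : 2 * 4 <= K%:R * (delta * alpha^-1) by apply: ler_pM.
    by apply: ler_wpM2r; lra.
  have : (64 * alpha^-1) ^+ 2 <= N%:R.
    apply: le_trans Nge.
    apply: (@le_trans _ _ ((64 * K%:R * (delta / alpha ^+ 2)) ^+ 2)).
      by rewrite lerXn2r // ?nnegrE; lra.
    by apply: ler_weXn2l (leq_trans K2 (leq_addr _ _)); lra.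
  move=> /(ler_wpM2l (ltW a0)); apply: le_trans.
  have -> : alpha * (64 * alpha^-1) ^+ 2 = 64 ^+ 2 * alpha^-1.
    by field; rewrite gt_eqF.
  by nra.
(* [L] is the radius that confines the spectrum, [M] the radius free of collisions, beyond which the
   [m] tails are small, and [S] the radius where the transform of [P] is large. The successor in [p]
   ensures [p >= 2 * alpha * N]. *)
pose m := Num.trunc (delta / alpha); pose L := Num.trunc (2 / alpha).
pose M := Num.trunc (16 * m%:R / alpha); pose S := Num.trunc (1 / (32 * alpha)).
pose p := (Num.trunc (2 * (alpha * N%:R))).+1.
have m4 : 4 <= delta / alpha by rewrite ler_pdivlMr //; lra.
have /andP[m1 m2] : m%:R <= delta / alpha < m.+1%:R by apply: truncn_itv; lra.
have /andP[L1 L2] : L%:R <= 2 / alpha < L.+1%:R by apply: truncn_itv; lra.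
have /andP[M1 M2] : M%:R <= 16 * m%:R / alpha < M.+1%:R.
  by apply: truncn_itv; rewrite divr_ge0 ?mulr_ge0 ?ler0n // ltW.
have /andP[S1 S2] : S%:R <= 1 / (32 * alpha) < S.+1%:R.
  by apply: truncn_itv; rewrite divr_ge0 ?mulr_ge0 // ltW.
have /andP[p1 p2] : 2 * (alpha * N%:R) <= p%:R <= 17 / 8 * (alpha * N%:R).
  have /andP[p1 p2] := @truncn_itv _ (2 * (alpha * N%:R)) ltac:(lra).
  by rewrite -/p in p2; rewrite ltW //= /p -natr1; lra.
have m3 : (3 < m)%N by rewrite -(ltr_nat R); rewrite -natr1 in m2; lra.
have N0 : 0 < N%:R :> R by rewrite ltr0n ltnW.
have ltpN : (p < N)%N by rewrite -(ltr_nat R); nra.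
have S32 : S%:R * (32 * alpha) <= 1 by rewrite -ler_pdivlMr //; lra.
have pS : (8 * (p * S) <= N)%N.
  rewrite -(ler_nat R) !natrM.
  have : p%:R * S%:R <= 17 / 8 * (alpha * N%:R) * S%:R by apply: ler_wpM2r.
  by have := ler_wpM2r (ltW N0) S32; lra.
have m0 : (0 < m)%N by apply: ltn_trans m3.
have [q [dis c0 cP]] := exists_generic (zinterval N p) pN
  (room_for_generic N1 a0 h1 h2 K2 m0 m1 L1 M1 Nge).
rewrite card_zinterval // in cP.
have SM : (S <= M)%N.
  apply: le_truncn; rewrite ler_pdivrMr; last lra.
  have : 1 <= m%:R :> R by rewrite ler1n.
  have -> : 16 * m%:R / alpha * (32 * alpha) = 512 * m%:R :> R.
    by field; rewrite gt_eqF.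
  lra.
have SN : (S < N)%N by exact: lt_aux pS.
have small_val s : (s <= S)%N -> nat_of_ord (s%:R : 'Z_N) = s.
  by move=> sS; rewrite val_Zp_nat // modn_small //; apply: leq_ltn_trans SN.
have small_ball s : (s <= S)%N -> (s%:R : 'Z_N) \in zball N M.
  by move=> sS; rewrite inE small_val // geq_min (leq_trans sS SM).
have S16 : (16 <= S)%N.
  rewrite truncn_ge_nat; last by rewrite divr_ge0 //; lra.
  by rewrite ler_pdivlMr; lra.
have small_neq0 s : (0 < s <= S)%N -> (s%:R : 'Z_N) != 0.
  move=> /andP[s0 sS]; apply/eqP => /(congr1 (fun z : 'Z_N => nat_of_ord z)).
  by rewrite small_val //= => sE; rewrite sE in s0.
(* If [q i = 0], then [q i * 1 = q j * 0] is a collision for any [j != i], and such a [j] exists as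
   [m > 3]. *)
have uq i : q i \is a GRing.unit.
  apply: unit_ZN => //; apply/eqP => qi0.
  have [j ji] : exists j, j != i.
    have [->|] := eqVneq i (Ordinal m0); last first.
      by move=> ?; exists (Ordinal m0); rewrite eq_sym.
    by exists (Ordinal (ltn_trans (isT : (1 < 3)%N) m3)).
  move/eqP: ji; apply; apply: esym.
  apply: (no_collision (s := 1%:R) (t := 0%:R) c0).
  - by apply: small_ball; apply: leq_trans S16.
  - exact: small_ball.
  - by apply: small_neq0; rewrite (leq_trans _ S16).
  - by rewrite qi0 mul0r mulr0.
have [A1 A2 A3 A4] := dilate_union_spectrum N1 ltpN a0 h1 h2
  (introT andP (conj m1 m2)) (introT andP (conj p1 p2)) L2 M2 uq c0 cP.
exists (dilate_union q (zinterval N p)); split => //.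
  (* The [m * S] frequencies [q i * s] with [1 <= s <= S] lie in the spectrum and are distinct by
     the absence of collisions; the successor skips [s = 0]. *)
  pose g (x : 'I_m * 'I_S) : 'Z_N := q x.1 * (x.2.+1)%:R.
  have inj : injective g.
    move=> [i s] [j t]; rewrite /g /= => E.
    have ij : i = j.
      apply: (no_collision c0 (small_ball _ _) (small_ball _ _) _ E);
        by [exact: ltn_ord|apply: small_neq0; rewrite ltn_ord].
    move: E; rewrite -ij => /(mulrI (uq i)) /(congr1 (fun z : 'Z_N => nat_of_ord z)).
    by rewrite !small_val ?ltn_ord // => -[/val_inj ->].
  have : (m * S <= #|large_spectrum alpha (dilate_union q (zinterval N p))|)%N.
    have -> : (m * S = #|[set g x | x : 'I_m * 'I_S]|)%N.
      by rewrite card_imset // card_prod !card_ord.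
    apply: subset_leq_card; apply/fintype.subsetP => _ /imsetP[[i s] _ ->].
    have sS := ltn_ord s; apply: A4.
    - exact: small_ball.
    - by apply: small_neq0; rewrite sS.
    - apply: wfourier_zinterval_ge => //; apply: leq_trans pS.
      by rewrite leq_mul2l /= leq_mul2l sS orbT.
  rewrite -(ler_nat R); apply: le_trans.
  by apply: spectrum_count_ge => //; rewrite ltnW.
move=> k kP; have [k2 _] := kP; have k0 : (0 < k)%N by apply: ltn_trans k2.
have p2k := admissible_pow2 d0 kP.
have nE : #|{: 'I_k + 'I_k}| = (k + k)%N by rewrite card_sum card_ord.
apply: (@le_trans _ _ #|balanced_words ('I_k + 'I_k)%type 'I_m (zball N L)|%:R).
  rewrite ler_nat; apply: (additive_energy_le m0 _ A3 (dis k (Kmax k kP))) => s.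
  exact: zballN.
apply: (le_trans (@card_balanced_words_le R _ _ m (zball N L) (5 * alpha^-1) _ _ _ _)).
- by rewrite nE addn_gt0 k0.
- apply: (@le_trans _ _ (2 * L.+1)%:R); first by rewrite ler_nat card_zball.
  by rewrite natrM -natr1; lra.
- by lra.
(* [2 ^+ (k + k) * delta <= 1] bounds this by [alpha^-1], below half of [5 * alpha^-1]. *)
- rewrite nE; apply: (@le_trans _ _ (2 ^+ (k + k) * (delta / alpha))).
    by apply: ler_wpM2l => //; apply: exprn_ge0.
  by rewrite mulrA; have := ler_wpM2r (ltW (_ : 0 < alpha^-1)) p2k; lra.
rewrite nE.
exact: word_count_le (ltW d0) m1 k0.
Qed.
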